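(* Let $C_{(<,>)}(x,y)$ be the bivariate generating function of the Catalan words avoiding the ordered pair of relations $(<,>)$, where $x$ marks the length and $y$ marks the number of descents. Then $$C_{(<,>)}(x,y)=\frac{1 - 2 x + 2 x y - x^2 y - \sqrt{1 - 4 x + 4 x^2 - 2 x^2 y + x^4 y^2}}{2 x y (1 - x)}.$$
   Context: A Catalan word of length $n$ is a word $w=w_1w_2\cdots w_n$ over the non-negative integers with $w_1=0$ and $0\leq w_i\leq w_{i-1}+1$ for $i=2,\dots,n$; the empty word is the unique Catalan word of length $0$. For relations $X,Y\in\{<,>,\leq,\geq,=,\neq\}$, a word $w$ contains the pattern $(X,Y)$ if there is an index $i\geq 1$ (with $i+2\le n$) such that $w_i\,X\,w_{i+1}$ and $w_{i+1}\,Y\,w_{i+2}$; otherwise $w$ avoids $(X,Y)$. The number of descents $\mathrm{des}(w)$ is the number of indices $i$ with $w_i>w_{i+1}$. The bivariate generating function is $C_{(X,Y)}(x,y)=\sum_{w}x^{|w|}y^{\mathrm{des}(w)}$, the sum being over all Catalan words $w$ (of any length $|w|\geq 0$) avoiding $(X,Y)$. Identities are between formal power series in $x$ with coefficients polynomials in $y$ (after clearing denominators); the square root of a power series with constant term $1$ is the one with constant term $1$. *)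

(* Defs.v *)
From HB Require Import structures.
From mathcomp Require Import all_boot all_order all_algebra.
From mathcomp Require Import boolp classical_sets.

Set Implicit Arguments.
Unset Strict Implicit.
Unset Printing Implicit Defensive.

Import GRing.Theory.
Local Open Scope ring_scope.

(** * Formal power series in one variable *)

Record fps (R : Type) := FPS { fps_coef : nat -> R }.

HB.instance Definition _ (R : Type) := gen_eqMixin (fps R).
HB.instance Definition _ (R : Type) := gen_choiceMixin (fps R).

Lemma fpsP (R : Type) (f g : fps R) :
  (forall n, fps_coef f n = fps_coef g n) -> f = g.
Proof. by case: f g => [f] [g] /= /funext ->. Qed.

Section Ring.
Variable R : comNzRingType.
Implicit Types f g h : fps R.

Definition fps_const (c : R) : fps R :=
  FPS (fun n => if n is 0 then c else 0).
Definition fps_var : fps R := FPS (fun n => (n == 1%N)%:R).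

Definition fps_add f g := FPS (fun n => fps_coef f n + fps_coef g n).
Definition fps_opp f := FPS (fun n => - fps_coef f n).
Definition fps_mul f g :=
  FPS (fun n => \sum_(i < n.+1) fps_coef f i * fps_coef g (n - i)%N).

Fact fps_addA : associative fps_add.
Proof. by move=> f g h; apply: fpsP => n /=; rewrite addrA. Qed.
Fact fps_addC : commutative fps_add.
Proof. by move=> f g; apply: fpsP => n /=; rewrite addrC. Qed.
Fact fps_add0 : left_id (fps_const 0) fps_add.
Proof. by move=> f; apply: fpsP => -[|n] /=; rewrite add0r. Qed.
Fact fps_addN : left_inverse (fps_const 0) fps_opp fps_add.
Proof. by move=> f; apply: fpsP => -[|n] /=; rewrite addNr. Qed.

HB.instance Definition _ :=
  GRing.isZmodule.Build (fps R) fps_addA fps_addC fps_add0 fps_addN.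

Let trunc n f : {poly R} := \poly_(i < n.+1) fps_coef f i.

Let coef_trunc n f i : (i <= n)%N -> (trunc n f)`_i = fps_coef f i.
Proof. by rewrite coef_poly ltnS => ->. Qed.

Let coef_mul n f g (p q : {poly R}) :
  (forall i, (i <= n)%N -> p`_i = fps_coef f i) ->
  (forall i, (i <= n)%N -> q`_i = fps_coef g i) ->
  forall i, (i <= n)%N -> (p * q)`_i = fps_coef (fps_mul f g) i.
Proof.
move=> pf qg i le_in; rewrite coefM /=; apply: eq_bigr => j _.
rewrite pf ?qg //; first exact: leq_trans (leq_subr _ _) le_in.
by rewrite (leq_trans _ le_in) // -ltnS.
Qed.

Fact fps_mulA : associative fps_mul.
Proof.
move=> f g h; apply: fpsP => n.
pose t e := @coef_trunc n e.
rewrite -(coef_mul (t f) (coef_mul (t g) (t h)) (leqnn n)).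
by rewrite -(coef_mul (coef_mul (t f) (t g)) (t h) (leqnn n)) mulrA.
Qed.
Fact fps_mulC : commutative fps_mul.
Proof.
move=> f g; apply: fpsP => n; pose t e := @coef_trunc n e.
by rewrite -(coef_mul (t f) (t g) (leqnn n)) mulrC (coef_mul (t g) (t f)).
Qed.
Fact fps_mul1 : left_id (fps_const 1) fps_mul.
Proof.
move=> f; apply: fpsP => n /=.
by rewrite big_ord_recl mul1r subn0 big1 ?addr0 // => i _; rewrite mul0r.
Qed.
Fact fps_mulDl : left_distributive fps_mul fps_add.
Proof.
move=> f g h; apply: fpsP => n /=; rewrite -big_split.
by apply: eq_bigr => i _; rewrite mulrDl.
Qed.
Fact fps_oner_neq0 : fps_const 1 != 0 :> fps R.
Proof. by apply/eqP => -[/(congr1 (@^~ 0%N))] /eqP; rewrite oner_eq0. Qed.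

HB.instance Definition _ := GRing.Zmodule_isComNzRing.Build (fps R)
  fps_mulA fps_mulC fps_mul1 fps_mulDl fps_oner_neq0.

(* The square root with constant term 1; [fps_sqrtP] and [fps_sqrt_unique]
   show that it exists and is unique when [f] has constant term 1 and 2 is
   invertible. *)
Definition fps_sqrt f : fps R :=
  xget 0 [set g : fps R | fps_coef g 0 = 1 /\ g ^+ 2 = f]%classic.

End Ring.

Section Sqrt.
Variable R : comUnitRingType.
Hypothesis unit2 : (2 : R) \is a GRing.unit.
Implicit Types f g : fps R.

Let fps_sqrS g n : fps_coef g 0 = 1 -> fps_coef (g ^+ 2) n.+1 =
  2 * fps_coef g n.+1 + \sum_(i < n) fps_coef g i.+1 * fps_coef g (n - i)%N.
Proof.
move=> g0; rewrite expr2 /= big_ord_recl big_ord_recr /= subn0 /bump /= add1n.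
rewrite subnn g0 mul1r mulr1 addrCA -mulr2n mulr_natl [LHS]addrC.
by congr (_ + _); apply: eq_bigr => i _; rewrite add1n subSS.
Qed.

Let sqrt_next f (s : seq R) : R :=
  if s is [::] then 1 else
  let n := (size s).-1 in
  2^-1 * (fps_coef f n.+1 - \sum_(i < n) s`_i.+1 * s`_(n - i)).

Let sqrt_seq f n := iter n (fun s => rcons s (sqrt_next f s)) [::].

Lemma fps_sqrt_exists f : fps_coef f 0 = 1 ->
  exists g, fps_coef g 0 = 1 /\ g ^+ 2 = f.
Proof.
move=> f0; pose c n := sqrt_next f (sqrt_seq f n).
have sz n : size (sqrt_seq f n) = n by elim: n => //= n IH; rewrite size_rcons IH.
have nthc n i : (i < n)%N -> (sqrt_seq f n)`_i = c i.
  elim: n => // n IH; rewrite ltnS leq_eqVlt /= nth_rcons sz.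
  by case/predU1P=> [->|lt_in]; rewrite ?ltnn ?eqxx // lt_in IH.
exists (FPS c); split=> //; apply: fpsP => -[|n].
  by rewrite expr2 /= big_ord_recl big_ord0 /= mulr1 addr0.
rewrite fps_sqrS //= {1}/c /sqrt_next.
case E: (sqrt_seq f n.+1) => [|a s]; first by have := sz n.+1; rewrite E.
rewrite -E sz succnK mulVKr // [X in _ - X](_ : _ = \sum_(i < n) c i.+1 * c (n - i)%N) ?subrK //.
by apply: eq_bigr => i _; rewrite !nthc // ltnS ?leq_subr // ltn_ord.
Qed.

Lemma fps_sqrt_inj g h : fps_coef g 0 = 1 -> fps_coef h 0 = 1 ->
  g ^+ 2 = h ^+ 2 -> g = h.
Proof.
move=> g0 h0 eq_gh; apply: fpsP; elim/ltn_ind=> -[|n] IH; first by rewrite g0.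
have := congr1 (@fps_coef _ ^~ n.+1) eq_gh; rewrite !fps_sqrS //.
have -> : \sum_(i < n) fps_coef g i.+1 * fps_coef g (n - i)%N =
          \sum_(i < n) fps_coef h i.+1 * fps_coef h (n - i)%N.
  by apply: eq_bigr => i _; rewrite !IH // ltnS ?leq_subr // ltn_ord.
by move/addIr/(mulrI unit2).
Qed.

Lemma fps_sqrtP f : fps_coef f 0 = 1 ->
  fps_coef (fps_sqrt f) 0 = 1 /\ fps_sqrt f ^+ 2 = f.
Proof. by move=> /fps_sqrt_exists[g Pg]; rewrite /fps_sqrt; case: xgetP => [h _ //|/(_ g)]. Qed.

Lemma fps_sqrt_unique f g :
  fps_coef g 0 = 1 -> g ^+ 2 = f -> fps_sqrt f = g.
Proof.
move=> g0 def_f; have f0 : fps_coef f 0 = 1.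
  by rewrite -def_f expr2 /= big_ord_recl big_ord0 /= g0 mulr1 addr0.
by have [s0 def_s] := fps_sqrtP f0; apply: fps_sqrt_inj => //; rewrite def_s.
Qed.

End Sqrt.

(** * Catalan words *)

Definition catalan_word (w : seq nat) : bool :=
  if w is a :: s then (a == 0%N) && path (fun m n => n <= m.+1)%N a s
  else true.

Definition contains (X Y : rel nat) (w : seq nat) : bool :=
  has (fun i => X (nth 0 w i) (nth 0 w i.+1) &&
                Y (nth 0 w i.+1) (nth 0 w i.+2))%N
      (iota 0 (size w).-2).

Definition avoids (X Y : rel nat) (w : seq nat) : bool := ~~ contains X Y w.

Definition des (w : seq nat) : nat :=
  count (fun i => nth 0 w i > nth 0 w i.+1)%N (iota 0 (size w).-1).

(* The letters of a Catalan word are smaller than its length, so the Catalan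
   words of length [n] are exactly those among the tuples over ['I_n]. *)
Lemma catalan_word_bound (w : seq nat) :
  catalan_word w -> all (fun a => a < size w)%N w.
Proof.
case: w => // a s /= /andP[/eqP-> p].
suff H t b : path (fun m n => n <= m.+1)%N b t ->
    all (fun a => a <= b + size t)%N t.
  by rewrite ltn0Sn; apply/allP => b /(allP (H _ _ p)).
elim: t b => //= b t IH c /andP[le_bc /IH]; rewrite addnS -addSn => H.
rewrite (leq_trans le_bc) ?leq_addr //=; apply: sub_all H => d /leq_trans; apply.
by rewrite leq_add2r.
Qed.

(* The series variable marks the length, and the polynomial variable of the
   coefficients marks the number of descents. *)
Definition catalan_gf (X Y : rel nat) : fps {poly rat} :=
  FPS (fun n => \sum_(w : n.-tuple 'I_n |
                      let u := map val w in catalan_word u && avoids X Y u)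
                  'X^(des (map val w))).

(* Main.v *)
(** Every nonempty Catalan word is uniquely [0 (u+1) v] with [u] and [v] Catalan
    words. If [u] and [v] are both nonempty, the word has one descent more than
    [u] and [v] together, and avoids [(<,>)] iff [u] and [v] do and [0 (u+1)]
    does not end with an ascent. The nonempty avoiders [u] for which [0 (u+1)]
    does end with an ascent arise from an arbitrary avoider by appending one
    forced letter, so they are counted by [x C]. Hence
    [C = 1 + x (C + (C - 1) + y (C - x C - 1) (C - 1))], and completing the
    square in this quadratic equation gives the formula. *)

Require Import Defs.
From mathcomp Require Import all_boot all_order all_algebra.
From mathcomp Require Import ring.
Import GRing.Theory.
Local Open Scope ring_scope.

(** * The pattern and descents under shifting, joining and appending *)

Lemma containsE X Y a b c s :
  contains X Y [:: a, b, c & s] = (X a b && Y b c) || contains X Y [:: b, c & s].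
Proof. by rewrite /contains /= (iotaDl 1 0) has_map. Qed.

Lemma desE a b s : des [:: a, b & s] = ((a > b)%N + des (b :: s))%N.
Proof. by rewrite /des /= (iotaDl 1 0) count_map. Qed.

Fixpoint ends_up (a : nat) (s : seq nat) : bool :=
  if s is b :: t then (if t is [::] then (a < b)%N else ends_up b t) else false.

Lemma contains_map_S s :
  contains ltn gtn (map S s) = contains ltn gtn s.
Proof.
by case: s => [//|a [//|b s]]; elim: s a b => // c s IH a b; rewrite !containsE IH.
Qed.

Lemma des_map_S s : des (map S s) = des s.
Proof. by case: s => // a s; elim: s a => // b s IH a; rewrite !desE IH. Qed.

(** The step into the 0 is a descent, so a factor centred at the last letter of [a :: s] is an
    occurrence exactly when [a :: s] ends with an ascent. A factor centred at the 0 would need an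
    ascent into 0. *)
Lemma contains_cat0 a s v : (0 < last a s)%N ->
  contains ltn gtn (a :: s ++ 0%N :: v) =
  [|| contains ltn gtn (a :: s), ends_up a s | contains ltn gtn (0%N :: v)].
Proof.
elim: s a => [|b [|c s] IH] a /= last_gt0.
- by case: v => // c v; rewrite containsE.
- by rewrite containsE IH //= last_gt0 andbT.
by rewrite !containsE IH //= orbA.
Qed.

Lemma des_cat0 a s v : (0 < last a s)%N ->
  des (a :: s ++ 0%N :: v) = (des (a :: s) + (des (0%N :: v)).+1)%N.
Proof.
elim: s a => [|b s IH] a /= last_gt0; first by rewrite desE last_gt0.
by rewrite !desE IH // addnA.
Qed.

Lemma contains_rcons a s b : (last a s <= b)%N ->
  contains ltn gtn (a :: rcons s b) = contains ltn gtn (a :: s).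
Proof.
elim: s a => [//|c [|d s] IH] a /= le_b.
  by rewrite containsE /= [(b < c)%N]ltnNge le_b andbF.
by rewrite !containsE IH.
Qed.

Lemma des_rcons a s b : (last a s <= b)%N -> des (a :: rcons s b) = des (a :: s).
Proof.
elim: s a => [|c s IH] a /= le_b; first by rewrite desE ltnNge le_b.
by rewrite !desE IH.
Qed.

Lemma ends_up_rcons a s b : ends_up a (rcons s b) = (last a s < b)%N.
Proof. by elim: s a => // c s IH a /=; rewrite -IH; case: s {IH}. Qed.

(** * Catalan words of given length and their decomposition *)

Definition words n : seq (seq nat) :=
  [seq map val (tval w) | w : n.-tuple 'I_n in
    [pred w : n.-tuple 'I_n | catalan_word (map val (tval w))]].

Lemma mem_words n w : (w \in words n) = catalan_word w && (size w == n).
Proof.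
apply/imageP/andP => [[t ct ->]|[cw /eqP sz]].
  by rewrite size_map size_tuple.
have [s def_w] : exists s : seq 'I_n, map val s = w.
  move: (catalan_word_bound cw); rewrite sz; elim: (w) => [|a t IH] /=.
    by exists [::].
  by case/andP=> lt_a /IH[s <-]; exists (Ordinal lt_a :: s).
have sz_s : size s == n by rewrite -(size_map val) def_w sz.
by exists (Tuple sz_s); rewrite ?inE /= def_w.
Qed.

Lemma words_uniq n : uniq (words n).
Proof.
rewrite map_inj_uniq ?enum_uniq // => s t eq_st.
by apply/val_inj/(inj_map val_inj eq_st).
Qed.

Lemma catalan_join u v : catalan_word u -> catalan_word v ->
  catalan_word (0%N :: map S u ++ v).
Proof.
move=> cu cv; rewrite /= cat_path; apply/andP; split.
  by case: u cu => //= a u /andP[/eqP-> pu]; rewrite path_map.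
by case: v cv => //= a v /andP[/eqP->].
Qed.

Lemma catalan_split w : catalan_word w -> w != [::] ->
  exists u v, [/\ catalan_word u, catalan_word v & w = 0%N :: map S u ++ v].
Proof.
case: w => // a s /= /andP[/eqP-> ps] _.
(* Cut [s] just before its first 0; the default value of [head] covers the case where [s] has no 0
   and [v] is empty. *)
have [u [v [def_s v0]]] : exists u v,
    s = map S u ++ v /\ head 0%N v == 0%N.
  elim: s {ps} => [|[|b] s [u [v [-> v0]]]]; first by exists [::], [::].
    by exists [::], (0%N :: map S u ++ v).
  by exists (b :: u), v.
exists u, v; move: ps; rewrite def_s cat_path => /andP[pu pv]; split=> //.
  case: u pu {def_s pv} => //= b u /andP[b0]; rewrite path_map => pu.
  by rewrite -leqn0 -ltnS b0.
by case: v v0 pv {def_s} => //= b v -> /andP[_ pv].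
Qed.

(** The cut is forced: raised letters are positive, while a nonempty Catalan word starts with 0. *)
Lemma join_inj u v u' v' : catalan_word v -> catalan_word v' ->
  map S u ++ v = map S u' ++ v' -> u = u' /\ v = v'.
Proof.
move=> cv cv'; elim: u u' => [|a u IH] [|a' u'] //=.
- by move=> def_v; rewrite def_v in cv.
- by move=> def_v; rewrite -def_v in cv'.
by case=> -> /IH[-> ->].
Qed.

(** * Series of weighted Catalan words *)

Section GeneratingFunctions.
Variable R : comNzRingType.
Implicit Types (F G : seq nat -> R) (f : fps R).

Definition gf F : fps R := FPS (fun n => \sum_(w <- words n) F w).

Lemma coef_fpsM f g n :
  fps_coef (f * g) n = \sum_(i < n.+1) fps_coef f i * fps_coef g (n - i)%N.
Proof. by []. Qed.

Lemma coef_fps_constM c f n : fps_coef (fps_const c * f) n = c * fps_coef f n.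
Proof.
by rewrite coef_fpsM big_ord_recl subn0 big1 ?addr0 // => i _; rewrite mul0r.
Qed.

Lemma coef0_fps_varM f : fps_coef (fps_var R * f) 0 = 0.
Proof. by rewrite coef_fpsM big_ord1 mul0r. Qed.

Lemma coefS_fps_varM f n : fps_coef (fps_var R * f) n.+1 = fps_coef f n.
Proof.
rewrite coef_fpsM big_ord_recl mul0r add0r big_ord_recl /= mul1r subSS subn0.
by rewrite big1 ?addr0 // => i _; rewrite mul0r.
Qed.

Lemma gfB F G : gf (fun w => F w - G w) = gf F - gf G.
Proof. by apply: fpsP => n /=; rewrite sumrB. Qed.

Lemma gf_nil : gf (fun w => (w == [::])%:R) = 1.
Proof.
apply: fpsP => n /=.
have [->|n_gt0] := posnP n.
  have -> : words 0 = [:: [::]].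
    apply/perm_small_eq => //; apply: uniq_perm; rewrite ?words_uniq // => w.
    by rewrite mem_words inE size_eq0; case: eqP => [->|]; rewrite ?andbF.
  by rewrite big_seq1.
rewrite big_seq big1 => [|w]; first by case: n n_gt0.
by rewrite mem_words => /andP[_ /eqP sz]; rewrite -size_eq0 sz eqn0Ngt n_gt0.
Qed.

Lemma coef_gfM F G n : fps_coef (gf F * gf G) n =
  \sum_(i < n.+1) \sum_(u <- words i) \sum_(v <- words (n - i)) F u * G v.
Proof. by rewrite coef_fpsM; apply: eq_bigr => i _; rewrite big_distrlr. Qed.

(** The right-hand side has the shape of [coef_gfM], so a weight that splits into products over [u]
    and [v] yields products of series. *)
Lemma sum_words_split F n : \sum_(w <- words n.+1) F w =
  \sum_(i < n.+1) \sum_(u <- words i) \sum_(v <- words (n - i))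
    F (0%N :: map S u ++ v).
Proof.
pose join (p : seq nat * seq nat) := 0%N :: map S p.1 ++ p.2.
pose pairs i := [seq (u, v) | u <- words i, v <- words (n - i)].
pose all_pairs := [seq p | i <- iota 0 n.+1, p <- pairs i].
have pairsP i p : p \in pairs i -> [/\ catalan_word p.1, size p.1 = i,
    catalan_word p.2 & size p.2 = (n - i)%N].
  case/allpairsP=> -[u v] /= [Wu Wv ->] /=; move: Wu Wv.
  by rewrite !mem_words => /andP[-> /eqP->] /andP[-> /eqP->].
have catalan2 p : p \in all_pairs -> catalan_word p.2.
  by case/allpairsPdep=> i [q [_ /pairsP[_ _ cq _] ->]].
have perm_words : perm_eq (words n.+1) (map join all_pairs).
  apply: uniq_perm; rewrite ?words_uniq //.
    rewrite map_inj_in_uniq => [|p q].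
      apply: allpairs_uniq_dep => [|i _|]; first exact: iota_uniq.
        by rewrite allpairs_uniq ?words_uniq // => -[u v] [u' v'].
      (* The index of the block containing a pair is the length of its first component. *)
      move=> [i p] [j q] /allpairsPdep[i' [p' [_ Pp [-> ->]]]].
      move=> /allpairsPdep[j' [q' [_ Pq [-> ->]]]] /= def_p.
      have [_ <- _ _] := pairsP _ _ Pp; have [_ <- _ _] := pairsP _ _ Pq.
      by rewrite def_p.
    case: p q => [u v] [u' v'] /catalan2/= cv /catalan2/= cv' [].
    by case/(join_inj _ _ _ _ cv cv')=> -> ->.
  move=> w; rewrite mem_words; apply/andP/mapP => [[cw sz_w]|].
    have [|u [v [cu cv def_w]]] := catalan_split w cw; first by case: (w) sz_w.
    exists (u, v) => //; move: sz_w; rewrite def_w /= size_cat size_map eqSS => /eqP sz.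
    apply/allpairsPdep; exists (size u), (u, v).
    rewrite mem_iota /= ltnS -sz leq_addr; split=> //.
    by apply/allpairsP; exists (u, v); rewrite !mem_words cu cv -sz addKn !eqxx.
  case=> p /allpairsPdep[i [q [le_i /pairsP[cu szu cv szv] ->]]] ->.
  split; first exact: catalan_join.
  rewrite /= eqSS size_cat size_map szu szv subnKC //.
  by rewrite mem_iota ltnS in le_i.
rewrite (perm_big _ perm_words) big_map big_allpairs_dep -(big_mkord xpredT (fun i =>
  \sum_(u <- words i) \sum_(v <- words (n - i)) F (0%N :: map S u ++ v))).
by rewrite /index_iota subn0; apply: eq_bigr => i _; rewrite big_allpairs_dep.
Qed.

(* A word [u] such that [0 (u+1)] ends with an ascent is determined by the word
   obtained by removing its last letter. *)
Lemma sum_words_ends_up F n :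
  \sum_(u <- words n.+1 | ends_up 0 (map S u)) F u =
  \sum_(u <- words n) F (rcons u (last 0%N (map S u))).
Proof.
rewrite -big_filter -(big_map (fun u => rcons u (last 0%N (map S u))) xpredT F).
apply/perm_big/uniq_perm; rewrite ?filter_uniq ?words_uniq //.
  by rewrite map_inj_uniq ?words_uniq // => u v /rcons_inj[].
move=> w; rewrite mem_filter mem_words.
(* This bounds the last letter above and [ends_up] bounds it below by the same value, which forces
   it. For empty [u] the default 0 of [last] is the only possible first letter. *)
have catalan_rcons u b : catalan_word (rcons u b) =
    catalan_word u && (b <= last 0%N (map S u))%N.
  case: u => [|a u] /=; first by rewrite andbT leqn0.
  by rewrite rcons_path andbA last_map.
apply/and3P/mapP => [[]|[u]].
  case/lastP: w => // u b; rewrite map_rcons ends_up_rcons catalan_rcons size_rcons.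
  rewrite ltnS => le_b /andP[cu ge_b] sz_u.
  exists u; first by rewrite mem_words cu.
  by congr rcons; apply/eqP; rewrite eqn_leq ge_b.
rewrite mem_words => /andP[cu sz_u] ->.
by rewrite map_rcons ends_up_rcons catalan_rcons size_rcons cu ltnS !leqnn.
Qed.

End GeneratingFunctions.

(** * The weights of avoiders and the functional equation *)

Definition avoid_wt (w : seq nat) : {poly rat} :=
  if avoids ltn gtn w then 'X^(des w) else 0.

Lemma catalan_gfE : catalan_gf ltn gtn = gf _ avoid_wt.
Proof.
apply: fpsP => n /=; rewrite big_image [RHS]big_mkcond [LHS]big_mkcond /=.
apply: eq_bigr => t _; rewrite /avoid_wt inE.
by case: (catalan_word _) (avoids _ _ _) => [] [].
Qed.

(** The new initial ascent from 0 to 1 is never followed by a descent, since all raised letters are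
    at least 1. *)
Lemma avoid_wt_raise u : catalan_word u ->
  avoid_wt (0%N :: map S u) = avoid_wt u.
Proof.
rewrite /avoid_wt /avoids -[in RHS]contains_map_S -[in RHS]des_map_S.
case: u => // a u /= /andP[/eqP-> _]; rewrite desE /=.
by case: u => // b u; rewrite /= containsE.
Qed.

Lemma avoid_wt_ext u :
  avoid_wt (rcons u (last 0%N (map S u))) = avoid_wt u.
Proof.
case: u => // a u; rewrite /avoid_wt /avoids rcons_cons /= last_map.
by rewrite contains_rcons ?des_rcons ?leqnSn.
Qed.

(** Keeps the avoiders [u] for which 0 (u+1) can be followed by a 0 without creating the pattern. *)
Definition no_peak_wt (u : seq nat) : {poly rat} :=
  if ends_up 0 (map S u) then 0 else avoid_wt u.

(** The three terms stand for [u] empty, only [v] empty, and both nonempty. Both weights are 1 on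
    the empty word, so subtracting [one] removes it; the factor ['X] is the descent at the
    junction. *)
Lemma avoid_wt_join u v : catalan_word u -> catalan_word v ->
  let one w : {poly rat} := (w == [::])%:R in
  avoid_wt (0%N :: map S u ++ v) =
    one u * avoid_wt v + (avoid_wt u - one u) * one v
    + 'X * ((no_peak_wt u - one u) * (avoid_wt v - one v)).
Proof.
move=> cu cv /=; have wt0 : avoid_wt [::] = 1 by rewrite /avoid_wt expr0.
case: u cu => [|a u] cu.
  rewrite /no_peak_wt /= wt0 subrr !mul0r mulr0 mul1r !addr0.
  case: v cv => [|b v] /=; first by rewrite wt0 /avoid_wt expr0.
  case/andP=> /eqP-> _; rewrite /avoid_wt /avoids desE.
  by case: v => // c v; rewrite containsE.
case: v cv => [|b v] cv.
  by rewrite cats0 avoid_wt_raise // wt0 /= subrr !mulr0 mul0r mulr1 subr0 add0r addr0.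
have last_gt0 : (0 < last 0%N (map S (a :: u)))%N by rewrite /= last_map.
have /= /andP[/eqP b0 _] := cv; rewrite {}b0 in cv *.
rewrite /no_peak_wt -(avoid_wt_raise (a :: u)) //.
rewrite -[a.+1 :: _ ++ _]/(map S (a :: u) ++ 0%N :: v).
move: (map S (a :: u)) last_gt0 => U last_gt0.
rewrite /= mul0r add0r mulr0 add0r !subr0.
rewrite /avoid_wt /avoids contains_cat0 // des_cat0 //.
case: (contains _ _ (0%N :: U)) => /=; first by rewrite if_same mul0r mulr0.
case: (ends_up 0 U) => /=; first by rewrite mul0r mulr0.
case: contains => /=; first by rewrite !mulr0.
by rewrite addnS exprS exprD.
Qed.

(** The discarded avoiders of length n+1 correspond, with equal weight by [avoid_wt_ext], to all
    avoiders of length n. *)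
Lemma gf_no_peak : gf _ no_peak_wt = (1 - fps_var _) * gf _ avoid_wt.
Proof.
rewrite mulrBl mul1r; apply: fpsP => n.
rewrite -[RHS]/(fps_coef (gf _ avoid_wt) n - fps_coef (fps_var _ * gf _ avoid_wt) n).
case: n => [|n].
  rewrite coef0_fps_varM subr0 /= !big_seq; apply: eq_bigr => w.
  by rewrite mem_words size_eq0 => /andP[_ /eqP->].
rewrite coefS_fps_varM /= [in RHS](bigID (fun u => ends_up 0 (map S u))) /=.
rewrite sum_words_ends_up (eq_bigr _ (fun u _ => avoid_wt_ext u)) addrAC subrr add0r.
rewrite [RHS]big_mkcond; apply: eq_bigr => u _; rewrite /no_peak_wt.
by case: ends_up.
Qed.

Lemma catalan_gf_rec (x := fps_var {poly rat}) (y := fps_const 'X)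
    (C := catalan_gf ltn gtn) :
  C = 1 + x * (C + (C - 1) + y * (((1 - x) * C - 1) * (C - 1))).
Proof.
rewrite {}/C catalan_gfE -gf_no_peak; set F := gf _ avoid_wt.
set E := gf _ no_peak_wt; set H := F + (F - 1) + _.
pose one := gf {poly rat} (fun w => (w == [::])%:R).
(* With 1 written as the series of the empty word, every term is a product of two series, matching
   [avoid_wt_join] term by term. *)
have defH : H = one * F + (F - one) * one + y * ((E - one) * (F - one)).
  by rewrite /one gf_nil mul1r mulr1.
apply: fpsP => n; rewrite -[RHS]/(fps_coef 1 n + fps_coef (x * H) n).
case: n => [|n].
  rewrite coef0_fps_varM addr0 -[1]gf_nil /= !big_seq; apply: eq_bigr => w.
  rewrite mem_words size_eq0 => /andP[_ /eqP->].
  by rewrite /avoid_wt expr0.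
rewrite coefS_fps_varM add0r [LHS]sum_words_split defH -!gfB.
set A := one * F; set B := _ * one; set D := _ * gf _ _.
rewrite -[RHS]/(fps_coef A n + fps_coef B n + fps_coef (y * D) n).
rewrite coef_fps_constM !coef_gfM mulr_sumr -!big_split /=.
apply: eq_bigr => i _; rewrite mulr_sumr -!big_split /=.
rewrite !big_seq; apply: eq_bigr => u; rewrite mem_words => /andP[cu _].
rewrite mulr_sumr -!big_split !big_seq; apply: eq_bigr => v.
by rewrite mem_words => /andP[cv _]; rewrite avoid_wt_join.
Qed.

Theorem theorem3p7 :
  let x : fps {poly rat} := fps_var {poly rat} in
  let y : fps {poly rat} := fps_const 'X in
  let C : fps {poly rat} := catalan_gf ltn gtn in
  2 * x * y * (1 - x) * C =
    1 - 2 * x + 2 * x * y - x ^+ 2 * y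
    - fps_sqrt (1 - 4 * x + 4 * x ^+ 2 - 2 * x ^+ 2 * y + x ^+ 4 * y ^+ 2).
Proof.
move=> x y C.
have unit2 : (2 : {poly rat}) \is a GRing.unit.
  by rewrite -polyC_natr poly_unitE size_polyC coefC.
set N := 1 - 2 * x + 2 * x * y - x ^+ 2 * y; set A := 2 * x * y * (1 - x) * C.
rewrite (fps_sqrt_unique unit2 (g := N - A)); first by rewrite subKr.
  (* Uniqueness of the square root leaves two checks on [N - A]: its constant term and its
     square. *)
  have -> : N - A = 1 + x * (2 * y - 2 - x * y - 2 * y * (1 - x) * C).
    by rewrite /N /A; ring.
  by rewrite -[LHS]/(1 + fps_coef (x * _) 0) coef0_fps_varM addr0.
pose G := 1 + x * (C + (C - 1) + y * (((1 - x) * C - 1) * (C - 1))).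
have recC : C = G := catalan_gf_rec.
(* As a quadratic in [C], [G - C] has leading coefficient a = x y (1 - x) and linear coefficient -
   N. Since A = 2 a C, completing the square gives the discriminant plus 4 a (G - C), and the latter
   vanishes. *)
have -> : (N - A) ^+ 2 = 1 - 4 * x + 4 * x ^+ 2 - 2 * x ^+ 2 * y + x ^+ 4 * y ^+ 2
    + 4 * x * y * (1 - x) * (C - G) * (- 1).
  by rewrite /N /A /G; ring.
by rewrite -recC subrr mulr0 mul0r addr0.
Qed.
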